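(* For every nonnegative integer $r$ there exists a form $f$ in 3 variables of degree 8 such that $H_f(x)$ is positive definite for all $x\in\mathbb{R}^3\setminus\{0\}$, but $f$ is not $r$-sos-convex.
   Context: $H_f(x)$ is the Hessian matrix of $f$ at $x$. A polynomial is a sum of squares if it equals $\sum_i q_i^2$ for polynomials $q_i$. For a nonnegative integer $r$, a polynomial $f$ in $x=(x_1,\dots,x_n)$ is called $r$-sos-convex if the polynomial $y^TH_f(x)y\cdot\left(\sum_{i=1}^n x_i^2\right)^r$ in the variables $(x,y)\in\mathbb{R}^{2n}$ is a sum of squares. *)

(* Defs.v *)
From Stdlib Require Import Reals List Arith.
Open Scope R_scope.

(* exponent vector: variable index -> exponent (only indices < n matter) *)
Definition monom := nat -> nat.
Definition mpoly := list (R * monom).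

Fixpoint rsum (n : nat) (g : nat -> R) : R :=
  match n with O => 0 | S k => rsum k g + g k end.
Fixpoint rprod (n : nat) (g : nat -> R) : R :=
  match n with O => 1 | S k => rprod k g * g k end.
Fixpoint natsum (n : nat) (e : monom) : nat :=
  match n with O => O | S k => (natsum k e + e k)%nat end.

Definition eval_mon (n : nat) (e : monom) (x : nat -> R) : R :=
  rprod n (fun i => x i ^ e i).
Definition peval (n : nat) (p : mpoly) (x : nat -> R) : R :=
  fold_right (fun t acc => fst t * eval_mon n (snd t) x + acc) 0 p.

Definition mdeg (n : nat) (e : monom) : nat := natsum n e.

Definition is_form (n d : nat) (p : mpoly) : Prop :=
  Forall (fun t => mdeg n (snd t) = d) p /\ exists x, peval n p x <> 0.

Definition pderiv (i : nat) (p : mpoly) : mpoly :=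
  map (fun t => (fst t * INR (snd t i),
                 fun k => if Nat.eqb k i then pred (snd t i) else snd t k)) p.

Definition hess (i j : nat) (p : mpoly) : mpoly := pderiv i (pderiv j p).

Definition hessian_pd_away_from_0 (n : nat) (f : mpoly) : Prop :=
  forall x : nat -> R, (exists i, (i < n)%nat /\ x i <> 0) ->
  forall y : nat -> R, (exists i, (i < n)%nat /\ y i <> 0) ->
  rsum n (fun i => rsum n (fun j => y i * peval n (hess i j f) x * y j)) > 0.

Definition padd (p q : mpoly) : mpoly := p ++ q.
Definition pmul (p q : mpoly) : mpoly :=
  flat_map (fun a => map (fun b => (fst a * fst b, fun k => (snd a k + snd b k)%nat)) q) p.
Definition pone : mpoly := (1, fun _ => O) :: nil.
Fixpoint ppow (p : mpoly) (r : nat) : mpoly :=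
  match r with O => pone | S k => pmul p (ppow p k) end.
Fixpoint psum (n : nat) (g : nat -> mpoly) : mpoly :=
  match n with O => nil | S k => padd (psum k g) (g k) end.
Definition pvar (k : nat) : mpoly := (1, fun m => if Nat.eqb m k then 1%nat else O) :: nil.
(* view a polynomial in x_0..x_{n-1} inside the ring in 2n variables
   (x_0..x_{n-1}, y_0..y_{n-1}) = (z_0..z_{n-1}, z_n..z_{2n-1}) *)
Definition embed_x (n : nat) (p : mpoly) : mpoly :=
  map (fun t => (fst t, fun k => if Nat.ltb k n then snd t k else O)) p.

Definition hess_form (n : nat) (f : mpoly) : mpoly :=
  psum n (fun i => psum n (fun j =>
    pmul (pmul (pvar (n + i)) (embed_x n (hess i j f))) (pvar (n + j)))).
Definition r_poly (n r : nat) (f : mpoly) : mpoly :=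
  pmul (hess_form n f) (ppow (psum n (fun i => pmul (pvar i) (pvar i))) r).

(* p (in m variables) is a sum of squares of polynomials in m variables;
   polynomial identity over R is identity of polynomial functions *)
Definition is_sos (m : nat) (p : mpoly) : Prop :=
  exists qs : list mpoly, forall z : nat -> R,
    peval m p z = fold_right (fun q acc => (peval m q z) ^ 2 + acc) 0 qs.

Definition r_sos_convex (n r : nat) (f : mpoly) : Prop :=
  is_sos (2 * n) (r_poly n r f).

(* Main.v *)
Require Import Defs.
From Stdlib Require Import Reals List Arith Lra Lia.

(** Let [s] be a scaled Motzkin form in [(u,v,w)] plus a small positive definite sextic in
    even powers. Integrating [s] twice in [u] and adding [K (v^2+w^2)^4] gives an octic [f]
    with [f_uu = s]. Since [s > 0], and since [u^6 v^2] and [u^6 w^2] have positive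
    coefficients, a Schur complement estimate shows that the Hessian of [f] is positive
    definite once [K] is large.

    If [f] were [r]-sos-convex, then putting [y = (1,0,0)] and [(u,v,w) = (1, t x, t y)] would
    make [(M + t N_t) (1 + t^2 (x^2+y^2))^r] a sum of squares, [M] being the dehomogenized
    Motzkin polynomial. There is a linear functional [L] on all of R[x,y], nonnegative on
    squares, with [L M < 0]: it kills every monomial with an odd exponent and sends
    [x^2a y^2b] to [6^(wexp a b)], where the growth of [wexp] makes the moment matrix
    diagonally dominant. By continuity [L] is negative on the product for small [t > 0],
    whatever [r] is. *)

(** * Positive definiteness of the Hessian *)

(** Compare [q] with [k * p], where [k = A / d]: when [k * p <= q] the left side is at most
    [d * q ^ 3], otherwise at most [A * k ^ 2 * p ^ 3]. It serves to absorb a mixed term into an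
    arbitrarily small multiple of [u ^ 6] and a large multiple of [(v ^ 2 + w ^ 2) ^ 3]. *)
Lemma cubic_majorant (A d : R) : 0 < A -> 0 < d ->
  exists B, 0 < B /\ forall p q, 0 <= p -> 0 <= q -> A * (p * q ^ 2) <= d * q ^ 3 + B * p ^ 3.
Proof.
intros HA Hd. exists (A * (A / d) ^ 2).
assert (Hk : 0 < A / d) by now apply Rdiv_lt_0_compat.
assert (HAd : A = A / d * d) by (field; lra).
remember (A / d) as k eqn:Ek; clear Ek.
split; [apply Rmult_lt_0_compat; [lra | apply pow_lt; lra]|].
intros p q Hp Hq.
assert (Hq2 : 0 <= q ^ 2) by apply pow2_ge_0.
assert (Hp3 : 0 <= p ^ 3) by now apply pow_le.
assert (Hq3 : 0 <= q ^ 3) by now apply pow_le.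
destruct (Rle_dec (k * p) q) as [H | H].
- assert (A * (p * q ^ 2) <= d * q ^ 3).
  { replace (A * (p * q ^ 2)) with (d * (q ^ 2 * (k * p))) by (rewrite HAd; ring).
    replace (q ^ 3) with (q ^ 2 * q) by ring.
    apply Rmult_le_compat_l; [lra|]. now apply Rmult_le_compat_l. }
  assert (0 <= A * k ^ 2 * p ^ 3) by (apply Rmult_le_pos; [apply Rmult_le_pos; [lra | apply pow2_ge_0]|lra]).
  lra.
- assert (q ^ 2 <= (k * p) ^ 2) by (apply pow_incr; lra).
  assert (A * (p * q ^ 2) <= A * k ^ 2 * p ^ 3).
  { replace (A * k ^ 2 * p ^ 3) with (A * (p * (k * p) ^ 2)) by ring.
    apply Rmult_le_compat_l; [lra|]. now apply Rmult_le_compat_l. }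
  assert (0 <= d * q ^ 3) by (apply Rmult_le_pos; lra).
  lra.
Qed.

(** This is the AM-GM inequality for [p ^ 2 * q], [p * q ^ 2] and [s ^ 3]. Multiplying by
    [(p + q) ^ 2] turns the expression into a visibly nonnegative one. *)
Lemma motzkin_nonneg (p q s : R) : 0 <= p -> 0 <= q -> 0 <= s ->
  0 <= p ^ 2 * q + p * q ^ 2 + s ^ 3 - 3 * (s * p * q).
Proof.
intros Hp Hq Hs.
assert (E : (p + q) ^ 2 * (p ^ 2 * q + p * q ^ 2 + s ^ 3 - 3 * (s * p * q)) =
  p * q * (p + q + s) * (p + q - 2 * s) ^ 2 + (p - q) ^ 2 * s ^ 3) by ring.
assert (Hs3 : 0 <= s ^ 3) by now apply pow_le.
destruct (Req_dec (p + q) 0) as [H0 | H0].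
- replace p with 0 by lra. replace q with 0 by lra. lra.
- apply (Rmult_le_reg_l ((p + q) ^ 2)); [rewrite <- Rsqr_pow2; now apply Rlt_0_sqr|].
  rewrite E, Rmult_0_r.
  apply Rplus_le_le_0_compat; apply Rmult_le_pos; try apply pow2_ge_0; [|assumption].
  apply Rmult_le_pos; [now apply Rmult_le_pos | lra].
Qed.

(** Squaring reduces this to [4 * x ^ 2 * alpha * beta <= (alpha * x ^ 2 + beta) ^ 2]. It replaces a
    Schur complement without dividing by [alpha], which may vanish. *)
Lemma young (alpha beta x y : R) : 0 <= alpha -> 0 <= beta ->
  y ^ 2 <= alpha * beta -> - (alpha * x ^ 2 + beta) <= 2 * x * y.
Proof.
intros Ha Hb Hy.
assert (Hx : 0 <= x ^ 2) by apply pow2_ge_0.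
assert (Hax : 0 <= alpha * x ^ 2) by now apply Rmult_le_pos.
assert (H : Rsqr (2 * x * y) <= Rsqr (alpha * x ^ 2 + beta)).
{ unfold Rsqr.
  assert (x ^ 2 * y ^ 2 <= x ^ 2 * (alpha * beta)) by now apply Rmult_le_compat_l.
  assert (0 <= (alpha * x ^ 2 - beta) ^ 2) by apply pow2_ge_0.
  lra. }
apply Rsqr_neg_pos_le_0 in H; lra.
Qed.

(** * The octic form and its Hessian *)

Definition mon3 (a b c k : nat) : nat :=
  match k with 0 => a | 1 => b | 2 => c | _ => 0 end%nat.

(** Integrating [u ^ k] twice divides its coefficient by [(k + 1) * (k + 2)], whence 56, 30,
    [3 / 12 = 1 / 4] and 2. The terms in [K] expand [K * (v ^ 2 + w ^ 2) ^ 4]. *)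
Definition octic (t K : R) : mpoly :=
  ((t ^ 6 + t ^ 7) / 56, mon3 8 0 0) ::
  (t ^ 7 / 30, mon3 6 2 0) :: (t ^ 7 / 30, mon3 6 0 2) ::
  (- t ^ 2 / 4, mon3 4 2 2) ::
  (t ^ 7 / 2, mon3 2 6 0) :: (t ^ 7 / 2, mon3 2 0 6) ::
  (1 / 2, mon3 2 4 2) :: (1 / 2, mon3 2 2 4) ::
  (K, mon3 0 8 0) :: (4 * K, mon3 0 6 2) :: (6 * K, mon3 0 4 4) ::
  (4 * K, mon3 0 2 6) :: (K, mon3 0 0 8) :: nil.

(** The first line is the Motzkin form in [v], [w], [t * u]. At [(1, t * x, t * y)] it is [t ^ 6]
    times the Motzkin polynomial, and the factor [t ^ 7] leaves a perturbation of order [t]. *)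
Definition octic_uu (t u v w : R) : R :=
  v ^ 4 * w ^ 2 + v ^ 2 * w ^ 4 + t ^ 6 * u ^ 6 - 3 * t ^ 2 * u ^ 2 * v ^ 2 * w ^ 2
  + t ^ 7 * (u ^ 6 + v ^ 6 + w ^ 6 + u ^ 4 * v ^ 2 + u ^ 4 * w ^ 2).

Lemma peval_hess_octic_uu t K x :
  peval 3 (hess 0 0 (octic t K)) x = octic_uu t (x 0%nat) (x 1%nat) (x 2%nat).
Proof. unfold octic_uu; cbn -[pow INR]. rewrite !INR_IZR_INZ; cbn -[pow]. field. Qed.

(* [f_uv = u v cross_v u v w] and [f_uw = u w cross_v u w v], up to the argument [t]. *)
Definition cross_v (t u v w : R) : R :=
  4 * v ^ 2 * w ^ 2 + 2 * w ^ 4 - 2 * t ^ 2 * u ^ 2 * w ^ 2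
  + t ^ 7 * (2 / 5 * u ^ 4 + 6 * v ^ 4).

(** The last summand is the Hessian of [K * rho ^ 4] with [rho = v ^ 2 + w ^ 2]: a multiple of the
    identity on [(b, c)] plus a rank-one term, both nonnegative for [K >= 0]. *)
Lemma hessian_form_octic t K x y :
  let u := x 0%nat in let v := x 1%nat in let w := x 2%nat in
  let a := y 0%nat in let b := y 1%nat in let c := y 2%nat in
  rsum 3 (fun i => rsum 3 (fun j => y i * peval 3 (hess i j (octic t K)) x * y j)) =
  a ^ 2 * octic_uu t u v w
  + 2 * (a * u) * (b * v * cross_v t u v w + c * w * cross_v t u w v)
  + b ^ 2 * (6 * u ^ 2 * v ^ 2 * w ^ 2 + u ^ 2 * w ^ 4 - t ^ 2 / 2 * u ^ 4 * w ^ 2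
             + t ^ 7 * (u ^ 6 / 15 + 15 * u ^ 2 * v ^ 4))
  + c ^ 2 * (6 * u ^ 2 * v ^ 2 * w ^ 2 + u ^ 2 * v ^ 4 - t ^ 2 / 2 * u ^ 4 * v ^ 2
             + t ^ 7 * (u ^ 6 / 15 + 15 * u ^ 2 * w ^ 4))
  + 2 * b * c * (4 * u ^ 2 * v * w * (v ^ 2 + w ^ 2) - t ^ 2 * u ^ 4 * v * w)
  + K * (8 * (v ^ 2 + w ^ 2) ^ 3 * (b ^ 2 + c ^ 2)
         + 48 * (v ^ 2 + w ^ 2) ^ 2 * (b * v + c * w) ^ 2).
Proof.
intros; unfold octic_uu, cross_v; cbn -[pow INR]. rewrite !INR_IZR_INZ; cbn -[pow].
subst u v w a b c. field.
Qed.

Lemma pow_unit_interval t n : 0 < t <= 1 -> 0 <= t ^ n <= 1.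
Proof.
intros Ht; split; [apply pow_le; lra|].
rewrite <- (pow1 n); apply pow_incr; lra.
Qed.

Lemma unit_scale_bounds s x : 0 <= s <= 1 -> 0 <= x -> 0 <= s * x <= x.
Proof. intros Hs Hx; split; nra. Qed.

Lemma sqr_le_of_abs_le x M : - M <= x <= M -> x ^ 2 <= M ^ 2.
Proof. intros Hx; nra. Qed.

Lemma cross_v_bound t u v w : 0 < t <= 1 ->
  cross_v t u v w ^ 2 <= (11 * (u ^ 4 + (v ^ 2 + w ^ 2) ^ 2)) ^ 2.
Proof.
intros Ht; unfold cross_v.
assert (Hd := pow_unit_interval t 7 Ht).
assert (Hth := pow_unit_interval t 2 Ht).
revert Hd Hth; generalize (t ^ 7) (t ^ 2); intros d th Hd Hth.
replace (u ^ 4) with ((u ^ 2) ^ 2) by ring. replace (v ^ 4) with ((v ^ 2) ^ 2) by ring.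
replace (w ^ 4) with ((w ^ 2) ^ 2) by ring.
assert (Hz := pow2_ge_0 u); assert (Hp := pow2_ge_0 v); assert (Hq := pow2_ge_0 w).
revert Hz Hp Hq; generalize (u ^ 2) (v ^ 2) (w ^ 2); intros z p q Hz Hp Hq.
assert (Hpq : 0 <= p * q) by now apply Rmult_le_pos.
assert (Hzq : 0 <= z * q) by now apply Rmult_le_pos.
assert (Hz2 := pow2_ge_0 z). assert (Hp2 := pow2_ge_0 p). assert (Hq2 := pow2_ge_0 q).
assert (Hzq2 := pow2_ge_0 (z - q)).
assert (H1 := unit_scale_bounds th (z * q) Hth Hzq).
assert (H2 : 0 <= 2 / 5 * z ^ 2 + 6 * p ^ 2) by lra.
assert (H3 := unit_scale_bounds d _ Hd H2).
assert (Hpq2 := pow2_ge_0 (p - q)).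
apply sqr_le_of_abs_le; lra.
Qed.

(** The term [d * u ^ 6 / 15] comes from [u ^ 6 * v ^ 2] and [u ^ 6 * w ^ 2]. Apart from the [b * c]
    term, only the two terms in [- th / 2] can be negative; they cost at most [T * z ^ 2 / 2], and
    the [b * c] term at most [T * (2 * z ^ 2 + 2 * rho ^ 2)]. *)
Lemma yy_block_lower_bound d th u v w b c : 0 <= d -> 0 <= th <= 1 ->
  (b ^ 2 + c ^ 2) * (d * u ^ 6 / 15 - 4 * ((v ^ 2 + w ^ 2) * (u ^ 4 + (v ^ 2 + w ^ 2) ^ 2))) <=
  b ^ 2 * (6 * u ^ 2 * v ^ 2 * w ^ 2 + u ^ 2 * w ^ 4 - th / 2 * u ^ 4 * w ^ 2
             + d * (u ^ 6 / 15 + 15 * u ^ 2 * v ^ 4))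
  + c ^ 2 * (6 * u ^ 2 * v ^ 2 * w ^ 2 + u ^ 2 * v ^ 4 - th / 2 * u ^ 4 * v ^ 2
             + d * (u ^ 6 / 15 + 15 * u ^ 2 * w ^ 4))
  + 2 * b * c * (4 * u ^ 2 * v * w * (v ^ 2 + w ^ 2) - th * u ^ 4 * v * w).
Proof.
intros Hd Hth.
set (X := 2 * b * c * v * w).
set (T := (b ^ 2 + c ^ 2) * (v ^ 2 + w ^ 2)).
set (z := u ^ 2). set (rho := v ^ 2 + w ^ 2).
assert (Hz : 0 <= z) by apply pow2_ge_0.
assert (Hp := pow2_ge_0 v). assert (Hq := pow2_ge_0 w).
assert (Hb := pow2_ge_0 b). assert (Hc := pow2_ge_0 c).
assert (Hrho : 0 <= rho) by (unfold rho; lra).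
assert (HT : 0 <= T) by (apply Rmult_le_pos; unfold rho in *; lra).
assert (HX : - (T / 2) <= X <= T / 2).
{ assert (H1 := pow2_ge_0 (b * v - c * w)). assert (H2 := pow2_ge_0 (b * w - c * v)).
  assert (H3 := pow2_ge_0 (b * v + c * w)). assert (H4 := pow2_ge_0 (b * w + c * v)).
  unfold X, T; split; lra. }
assert (HbX : - (T * (2 * z ^ 2 + 2 * rho ^ 2)) <= X * (4 * z * rho - th * z ^ 2)).
{ assert (0 <= z * rho) by now apply Rmult_le_pos.
  assert (Hz2 := pow2_ge_0 z). assert (Hzr := pow2_ge_0 (z - rho)).
  assert (H0 := unit_scale_bounds th (z ^ 2) Hth Hz2).
  assert (Hr2 := pow2_ge_0 rho).
  assert (H1 : - (2 * (2 * z ^ 2 + 2 * rho ^ 2)) <= 4 * z * rho - th * z ^ 2 <= 2 * (2 * z ^ 2 + 2 * rho ^ 2)) by (split; lra).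
  revert H1; generalize (4 * z * rho - th * z ^ 2) (2 * z ^ 2 + 2 * rho ^ 2); intros; nra. }
assert (Hneg : th / 2 * z ^ 2 * (b ^ 2 * w ^ 2 + c ^ 2 * v ^ 2) <= 1 / 2 * z ^ 2 * T).
{ assert (Hz2 := pow2_ge_0 z).
  assert (0 <= b ^ 2 * w ^ 2) by now apply Rmult_le_pos.
  assert (0 <= c ^ 2 * v ^ 2) by now apply Rmult_le_pos.
  assert (0 <= b ^ 2 * v ^ 2) by now apply Rmult_le_pos.
  assert (0 <= c ^ 2 * w ^ 2) by now apply Rmult_le_pos.
  apply Rmult_le_compat; [nra | lra | nra | unfold T; lra]. }
assert (0 <= b ^ 2 * (6 * (z * (v ^ 2 * w ^ 2)) + z * (w ^ 2) ^ 2 + 15 * (d * (z * (v ^ 2) ^ 2)))).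
{ repeat first [apply Rplus_le_le_0_compat | apply pow2_ge_0 | apply Rmult_le_pos]; lra. }
assert (0 <= c ^ 2 * (6 * (z * (v ^ 2 * w ^ 2)) + z * (v ^ 2) ^ 2 + 15 * (d * (z * (w ^ 2) ^ 2)))).
{ repeat first [apply Rplus_le_le_0_compat | apply pow2_ge_0 | apply Rmult_le_pos]; lra. }
assert (0 <= T * z ^ 2) by (apply Rmult_le_pos; [lra | apply pow2_ge_0]).
assert (0 <= T * rho ^ 2) by (apply Rmult_le_pos; [lra | apply pow2_ge_0]).
unfold X, T, z, rho in *; lra.
Qed.

(** This lets the [a ^ 2] entry absorb its share of the mixed terms. The factor [1 / 4] comes from
    [(p + q) ^ 3 <= 4 * (p ^ 3 + q ^ 3)]. *)
Lemma sextic_lower_bound u v w :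
  1 / 4 * (u ^ 2 * (u ^ 4 + (v ^ 2 + w ^ 2) ^ 2)) <=
  u ^ 6 + v ^ 6 + w ^ 6 + u ^ 4 * v ^ 2 + u ^ 4 * w ^ 2.
Proof.
assert (Hz := pow2_ge_0 u); assert (Hp := pow2_ge_0 v); assert (Hq := pow2_ge_0 w).
replace (u ^ 4) with ((u ^ 2) ^ 2) by ring. replace (u ^ 6) with ((u ^ 2) ^ 3) by ring.
replace (v ^ 6) with ((v ^ 2) ^ 3) by ring. replace (w ^ 6) with ((w ^ 2) ^ 3) by ring.
revert Hz Hp Hq; generalize (u ^ 2) (v ^ 2) (w ^ 2); intros z p q Hz Hp Hq.
assert (Hcube : (p + q) ^ 3 <= 4 * (p ^ 3 + q ^ 3)).
{ assert (0 <= (p + q) * (p - q) ^ 2) by (apply Rmult_le_pos; [lra | apply pow2_ge_0]). lra. }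
assert (Hmix : z * (p + q) ^ 2 <= z ^ 3 + (p + q) ^ 3).
{   destruct (Rle_dec z (p + q)).
  - assert (0 <= (p + q - z) * (p + q) ^ 2) by (apply Rmult_le_pos; [lra | apply pow2_ge_0]).
    assert (0 <= z ^ 3) by now apply pow_le. lra.
  - assert (0 <= (z - (p + q)) * (z * (z + (p + q)))) by (repeat apply Rmult_le_pos; lra).
    assert (0 <= (p + q) ^ 3) by (apply pow_le; lra). lra. }
assert (0 <= z ^ 2 * p) by (apply Rmult_le_pos; [apply pow2_ge_0 | lra]).
assert (0 <= z ^ 2 * q) by (apply Rmult_le_pos; [apply pow2_ge_0 | lra]).
assert (0 <= z ^ 3) by now apply pow_le.
lra.
Qed.

Lemma octic_uu_lower_bound t u v w : 0 < t ->
  t ^ 7 * (u ^ 6 + v ^ 6 + w ^ 6 + u ^ 4 * v ^ 2 + u ^ 4 * w ^ 2) <= octic_uu t u v w.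
Proof.
intros Ht; unfold octic_uu.
assert (M := motzkin_nonneg (v ^ 2) (w ^ 2) ((t * u) ^ 2) (pow2_ge_0 _) (pow2_ge_0 _) (pow2_ge_0 _)).
lra.
Qed.

Lemma hessian_octic_pd t : 0 < t <= 1 ->
  exists K, hessian_pd_away_from_0 3 (octic t K).
Proof.
intros Ht.
assert (Hd : 0 < t ^ 7) by (apply pow_lt; lra).
assert (Hth := pow_unit_interval t 2 Ht).
remember (t ^ 7) as d eqn:Ed.
(* [W] is the total coefficient of [tau * rho * S] to be absorbed: [968 / d] from the mixed terms
   and 4 from the lower block. *)
set (W := 968 / d + 4).
assert (HW0 : 0 < 968 / d) by (apply Rdiv_lt_0_compat; lra).
destruct (cubic_majorant W (d / 30)) as [B [HB major]]; [unfold W; lra | lra |].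
(* The Hessian contributes [8 * K * rho ^ 3 * tau]: [B] pays for the cubic majorant, [W] for the
   [rho ^ 3] part of [rho * S], and 1 is the strict surplus. *)
exists ((B + W + 1) / 8).
intros x [i [Hi Hxi]] y [j [Hj Hyj]].
rewrite hessian_form_octic; cbv zeta.
assert (Hx : x 0%nat <> 0 \/ x 1%nat <> 0 \/ x 2%nat <> 0).
{ destruct i as [|[|[|]]]; auto. lia. }
assert (Hy : y 0%nat <> 0 \/ y 1%nat <> 0 \/ y 2%nat <> 0).
{ destruct j as [|[|[|]]]; auto. lia. }
clear Hi Hxi Hj Hyj i j; revert Hx Hy.
generalize (x 0%nat) (x 1%nat) (x 2%nat) (y 0%nat) (y 1%nat) (y 2%nat); clear x y.
intros u v w a b c Hx Hy.
assert (Huu := octic_uu_lower_bound t u v w (proj1 Ht)).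
assert (Hyy := yy_block_lower_bound d (t ^ 2) u v w b c (Rlt_le _ _ Hd) Hth).
rewrite <- Ed in *.
assert (Hsext := sextic_lower_bound u v w).
set (S := u ^ 4 + (v ^ 2 + w ^ 2) ^ 2) in *.
set (rho := v ^ 2 + w ^ 2) in *.
set (tau := b ^ 2 + c ^ 2) in *.
set (N := u ^ 6 + v ^ 6 + w ^ 6 + u ^ 4 * v ^ 2 + u ^ 4 * w ^ 2) in *.
assert (Hu2 := pow2_ge_0 u); assert (Hv2 := pow2_ge_0 v); assert (Hw2 := pow2_ge_0 w).
assert (Hb2 := pow2_ge_0 b); assert (Hc2 := pow2_ge_0 c); assert (Ha2 := pow2_ge_0 a).
assert (Hrho : 0 <= rho) by (unfold rho; lra).
assert (Htau : 0 <= tau) by (unfold tau; lra).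
assert (HS : 0 <= S).
{ unfold S; replace (u ^ 4) with ((u ^ 2) ^ 2) by ring. apply Rplus_le_le_0_compat; apply pow2_ge_0. }
(* The weights satisfy [d / 8 * (968 / d) = 11 ^ 2], the square of the constant in [cross_v_bound].
   The factor [d / 8] is small enough to use only half of [a ^ 2 * (d * N)]. *)
assert (Hmixed : - (d / 8 * S * (a * u) ^ 2 + 968 / d * (tau * rho * S)) <=
  2 * (a * u) * (b * v * cross_v t u v w + c * w * cross_v t u w v)).
{ apply young.
  - apply Rmult_le_pos; lra.
  - apply Rmult_le_pos; [lra|]. apply Rmult_le_pos; [now apply Rmult_le_pos | assumption].
  - assert (G1 := cross_v_bound t u v w Ht). assert (G2 := cross_v_bound t u w v Ht).
    rewrite (Rplus_comm (w ^ 2)) in G2. fold rho S in G1, G2.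
    revert G1 G2; generalize (cross_v t u v w) (cross_v t u w v); intros g1 g2 G1 G2.
    assert (CS : (b * v * g1 + c * w * g2) ^ 2 <= tau * (v ^ 2 * g1 ^ 2 + w ^ 2 * g2 ^ 2)).
    { assert (H := pow2_ge_0 (b * w * g2 - c * v * g1)). unfold tau; lra. }
    assert (E1 : v ^ 2 * g1 ^ 2 <= v ^ 2 * (11 * S) ^ 2) by now apply Rmult_le_compat_l.
    assert (E2 : w ^ 2 * g2 ^ 2 <= w ^ 2 * (11 * S) ^ 2) by now apply Rmult_le_compat_l.
    apply Rle_trans with (1 := CS).
    replace (d / 8 * S * (968 / d * (tau * rho * S))) with (tau * (v ^ 2 * (11 * S) ^ 2 + w ^ 2 * (11 * S) ^ 2))
      by (unfold rho; field; lra).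
    apply Rmult_le_compat_l; lra. }
assert (Hdiag : a ^ 2 * (d * N) <= a ^ 2 * octic_uu t u v w) by now apply Rmult_le_compat_l.
assert (Habs : d / 8 * S * (a * u) ^ 2 <= a ^ 2 * (d * N / 2)).
{ replace (d / 8 * S * (a * u) ^ 2) with (a ^ 2 * (d / 2 * (1 / 4 * (u ^ 2 * S)))) by field.
  apply Rmult_le_compat_l; [assumption|].
  replace (d * N / 2) with (d / 2 * N) by field. apply Rmult_le_compat_l; lra. }
assert (Hmaj := major rho (u ^ 2) Hrho Hu2).
assert (Hyytot : tau * (d * u ^ 6 / 30 + rho ^ 3) <=
  tau * (d * u ^ 6 / 15 - 4 * (rho * S)) - 968 / d * (tau * rho * S)
  + (B + W + 1) / 8 * (8 * rho ^ 3 * tau)).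
{ replace (tau * (d * u ^ 6 / 15 - 4 * (rho * S)) - 968 / d * (tau * rho * S)
     + (B + W + 1) / 8 * (8 * rho ^ 3 * tau))
   with (tau * (d * u ^ 6 / 15 - W * (rho * S) + (B + W + 1) * rho ^ 3)) by (unfold W; field; lra).
  apply Rmult_le_compat_l; [assumption|]. unfold S; lra. }
assert (Hlast : 0 <= (B + W + 1) / 8 * (48 * rho ^ 2 * (b * v + c * w) ^ 2)).
{ apply Rmult_le_pos; [unfold W; lra|]. apply Rmult_le_pos; [|apply pow2_ge_0].
  assert (H := pow2_ge_0 rho); lra. }
assert (pow6 : forall z, 0 <= z ^ 6) by (intros z; replace (z ^ 6) with ((z ^ 3) ^ 2) by ring; apply pow2_ge_0).
assert (pow6' : forall z, z <> 0 -> 0 < z ^ 6).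
{ intros z Hz. assert (H := pow6 z). assert (H' := pow_nonzero z 6 Hz). lra. }
assert (sqpos : forall z, z <> 0 -> 0 < z ^ 2).
{ intros z Hz. assert (H := pow2_ge_0 z). assert (H' := pow_nonzero z 2 Hz). lra. }
assert (HN : 0 < N).
{ assert (0 <= u ^ 4 * rho).
  { apply Rmult_le_pos; [replace (u ^ 4) with ((u ^ 2) ^ 2) by ring; apply pow2_ge_0 | assumption]. }
  assert (Pu := pow6 u). assert (Pv := pow6 v). assert (Pw := pow6 w).
  destruct Hx as [H' | [H' | H']]; apply pow6' in H'; unfold N, rho in *; lra. }
assert (HV : 0 < d * u ^ 6 / 30 + rho ^ 3).
{ assert (Hr3 : 0 <= rho ^ 3) by now apply pow_le.
  assert (Hdu : 0 <= d * u ^ 6) by (apply Rmult_le_pos; [lra | auto]).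
  destruct Hx as [H' | H'].
  - assert (0 < d * u ^ 6) by (apply Rmult_lt_0_compat; auto). lra.
  - assert (0 < rho) by (destruct H' as [H' | H']; apply sqpos in H'; unfold rho; lra).
    assert (0 < rho ^ 3) by now apply pow_lt. lra. }
assert (Hpos : 0 < a ^ 2 * (d * N / 2) + tau * (d * u ^ 6 / 30 + rho ^ 3)).
{ assert (0 < d * N) by now apply Rmult_lt_0_compat.
  destruct Hy as [H' | H'].
  - apply sqpos in H'. apply Rplus_lt_le_0_compat; [apply Rmult_lt_0_compat; lra | apply Rmult_le_pos; lra].
  - assert (0 < tau) by (destruct H' as [H' | H']; apply sqpos in H'; unfold tau; lra).
    apply Rplus_le_lt_0_compat; [apply Rmult_le_pos; lra | now apply Rmult_lt_0_compat]. }
apply Rlt_gt; lra.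
Qed.

Lemma octic_is_form t K : 0 < t -> is_form 3 8 (octic t K).
Proof.
intros Ht; split.
- repeat constructor.
- exists (fun k => if Nat.eqb k 0 then 1 else 0). cbn -[pow].
  assert (0 < t ^ 6) by now apply pow_lt. assert (0 < t ^ 7) by now apply pow_lt.
  simpl (_ ^ 8). lra.
Qed.

(** * Evaluation of the polynomial operations *)

Lemma peval_cons n a p x :
  peval n (a :: p) x = fst a * eval_mon n (snd a) x + peval n p x.
Proof. reflexivity. Qed.

Lemma peval_app n p q x : peval n (p ++ q) x = peval n p x + peval n q x.
Proof. induction p as [|a p IH]; cbn [app].
- simpl; ring.
- rewrite !peval_cons, IH; ring.
Qed.

Lemma eval_mon_add n e e' x :
  eval_mon n (fun k => (e k + e' k)%nat) x = eval_mon n e x * eval_mon n e' x.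
Proof.
unfold eval_mon; induction n as [|n IH]; cbn [rprod]; [ring|].
rewrite IH, pow_add; ring.
Qed.

Lemma peval_pmul n p q x : peval n (pmul p q) x = peval n p x * peval n q x.
Proof.
induction p as [|a p IH]; [simpl; ring|].
unfold pmul; cbn [flat_map]; fold (pmul p q).
rewrite peval_app, IH, peval_cons, Rmult_plus_distr_r; f_equal; clear IH.
induction q as [|b q IH]; cbn [map]; [simpl; ring|].
rewrite !peval_cons, IH; destruct a, b; cbn [fst snd]; rewrite eval_mon_add; ring.
Qed.

Lemma peval_pone n x : peval n pone x = 1.
Proof.
assert (E : eval_mon n (fun _ => 0%nat) x = 1).
{ unfold eval_mon; induction n as [|n IH]; cbn [rprod]; [|rewrite IH]; simpl; ring. }
unfold pone; rewrite peval_cons; cbn [fst snd]; rewrite E; simpl; ring.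
Qed.

Lemma peval_ppow n p r x : peval n (ppow p r) x = peval n p x ^ r.
Proof.
induction r as [|r IH]; [apply peval_pone|].
cbn [ppow]; rewrite peval_pmul, IH; reflexivity.
Qed.

Lemma peval_psum n m g x : peval n (psum m g) x = rsum m (fun i => peval n (g i) x).
Proof.
induction m as [|m IH]; [reflexivity|].
cbn [psum rsum]; unfold padd; rewrite peval_app, IH; reflexivity.
Qed.

Lemma peval_pvar n k x : (k < n)%nat -> peval n (pvar k) x = x k.
Proof.
intros Hk.
assert (E : forall m, eval_mon m (fun i => if Nat.eqb i k then 1%nat else 0%nat) x =
  if Nat.ltb k m then x k else 1).
{ unfold eval_mon; induction m as [|m IH]; [reflexivity|].
  cbn [rprod]; rewrite IH.
  destruct (Nat.ltb_spec k m), (Nat.ltb_spec k (S m)), (Nat.eqb_spec m k);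
    try lia; subst; simpl; ring. }
unfold pvar; rewrite peval_cons; cbn [fst snd]; rewrite E.
apply Nat.ltb_lt in Hk; rewrite Hk; simpl; ring.
Qed.

Lemma peval_embed_x n p z : peval (n + n) (embed_x n p) z = peval n p z.
Proof.
assert (E : forall e m, eval_mon (n + m) (fun k => if Nat.ltb k n then e k else 0%nat) z = eval_mon n e z).
{ intros e m; unfold eval_mon; induction m as [|m IH].
  - rewrite Nat.add_0_r.
    assert (E : forall l, (l <= n)%nat -> rprod l (fun i => z i ^ (if Nat.ltb i n then e i else 0)) =
       rprod l (fun i => z i ^ e i)).
    { induction l as [|l IHl]; intros Hl; [reflexivity|].
      cbn [rprod]; rewrite IHl by lia.
      replace (Nat.ltb l n) with true by (symmetry; apply Nat.ltb_lt; lia). reflexivity. }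
    now apply E.
  - rewrite Nat.add_succ_r; cbn [rprod]; rewrite IH.
    replace (Nat.ltb (n + m) n) with false by (symmetry; apply Nat.ltb_ge; lia). simpl; ring. }
induction p as [|a p IH]; [reflexivity|].
unfold embed_x; cbn [map]; rewrite !peval_cons; cbn [fst snd]; rewrite E.
f_equal; exact IH.
Qed.

Lemma rsum_ext n g h : (forall i, (i < n)%nat -> g i = h i) -> rsum n g = rsum n h.
Proof.
intros E; induction n as [|n IH]; [reflexivity|].
cbn [rsum]; rewrite E by lia; rewrite IH by (intros; apply E; lia); reflexivity.
Qed.

Lemma peval_r_poly n r f z : peval (2 * n) (r_poly n r f) z =
  rsum n (fun i => rsum n (fun j => z (n + i)%nat * peval n (hess i j f) z * z (n + j)%nat))
  * rsum n (fun i => z i ^ 2) ^ r.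
Proof.
unfold r_poly, hess_form; rewrite peval_pmul, peval_ppow, !peval_psum.
f_equal; [|f_equal]; apply rsum_ext; intros i Hi.
- rewrite peval_psum; apply rsum_ext; intros j Hj.
  rewrite !peval_pmul, !peval_pvar by lia.
  replace (2 * n)%nat with (n + n)%nat by lia.
  now rewrite peval_embed_x.
- rewrite peval_pmul, !peval_pvar by lia; ring.
Qed.

(** Indices 0 to 2 hold the base point and 3 to 5 the direction [(1, 0, 0)], so the Hessian form
    reduces to [octic_uu], where [K] does not occur. *)
Definition slice_point (t x y : R) (k : nat) : R :=
  match k with 0%nat => 1 | 1%nat => t * x | 2%nat => t * y | 3%nat => 1 | _ => 0 end.

Lemma r_poly_octic_slice r t K x y :
  peval 6 (r_poly 3 r (octic t K)) (slice_point t x y) =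
  t ^ 6 * ((x ^ 4 * y ^ 2 + x ^ 2 * y ^ 4 + 1 - 3 * x ^ 2 * y ^ 2
      + t * (1 + t ^ 2 * (x ^ 2 + y ^ 2) + t ^ 6 * (x ^ 6 + y ^ 6)))
    * (1 + t ^ 2 * (x ^ 2 + y ^ 2)) ^ r).
Proof.
rewrite (peval_r_poly 3).
rewrite <- Rmult_assoc; f_equal; [|f_equal]; cbn [rsum slice_point Nat.add]; [|ring].
rewrite peval_hess_octic_uu; unfold octic_uu, slice_point; ring.
Qed.

(** Since [t ^ 6] is the square of [t ^ 3], dividing by it preserves sums of squares. *)
Lemma scaled_slice_sos r t K qs : t <> 0 ->
  (forall z, peval 6 (r_poly 3 r (octic t K)) z =
     fold_right (fun q acc => peval 6 q z ^ 2 + acc) 0 qs) ->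
  forall x y,
  (x ^ 4 * y ^ 2 + x ^ 2 * y ^ 4 + 1 - 3 * x ^ 2 * y ^ 2
      + t * (1 + t ^ 2 * (x ^ 2 + y ^ 2) + t ^ 6 * (x ^ 6 + y ^ 6)))
    * (1 + t ^ 2 * (x ^ 2 + y ^ 2)) ^ r =
  fold_right (fun q acc => (peval 6 q (slice_point t x y) * / t ^ 3) ^ 2 + acc) 0 qs.
Proof.
intros Ht sos x y.
assert (scale : forall l,
  t ^ 6 * fold_right (fun q acc => (peval 6 q (slice_point t x y) * / t ^ 3) ^ 2 + acc) 0 l =
  fold_right (fun q acc => peval 6 q (slice_point t x y) ^ 2 + acc) 0 l).
{ induction l as [|q l IH]; cbn [fold_right]; [ring|].
  rewrite <- IH; field; exact Ht. }
apply (Rmult_eq_reg_l (t ^ 6)); [|now apply pow_nonzero].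
rewrite scale, <- sos; symmetry; apply r_poly_octic_slice.
Qed.

From mathcomp Require Import all_boot all_order all_algebra.
From mathcomp Require Import zify ring lra Rstruct.
Set Implicit Arguments.
Unset Strict Implicit.
Unset Printing Implicit Defensive.
Import Order.TTheory GRing.Theory Num.Theory.
Local Open Scope ring_scope.

(** * A functional on bivariate polynomials separating the Motzkin polynomial from squares *)

Lemma poly_fun_eq0 (R : idomainType) (g : nat -> R) (p : {poly R}) :
  injective g -> (forall n, root p (g n)) -> p = 0.
Proof.
move=> ginj proot; apply/eqP/contraT => p0.
have := max_poly_roots p0 (rs := map g (iota 0 (size p))).
rewrite size_map size_iota ltnn => -> //.
  by apply/allP => _ /mapP[n _ ->].
by rewrite map_inj_uniq ?iota_uniq.
Qed.

(** The points with natural coordinates already suffice, one variable at a time. This passes from an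
    identity of functions to one of coefficients, on which the functional is defined. *)
Lemma bipoly_fun_eq0 (F : numDomainType) (p : {poly {poly F}}) :
  (forall x y, p.[y%:P].[x] = 0) -> p = 0.
Proof.
move=> p0; have natr_inj : injective (fun n => n%:R : F).
  by move=> m n /eqP; rewrite eqr_nat => /eqP.
apply: (@poly_fun_eq0 _ (fun n => n%:R%:P)) => [m n /polyC_inj /natr_inj //|n].
apply/eqP; apply: (@poly_fun_eq0 _ (fun n => n%:R)) => // m.
by apply/eqP; rewrite p0.
Qed.

Lemma poly_neg_near0 (F : realFieldType) (p : {poly F}) :
  p.[0] < 0 -> exists2 t, 0 < t <= 1 & p.[t] < 0.
Proof.
elim/poly_ind: p => [|p c _]; first by rewrite horner0 ltxx.
rewrite !hornerE => c_lt0.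
pose B := \sum_(i < size p) `|p`_i|.
have B_ge0 : 0 <= B by apply: sumr_ge0 => *; apply: normr_ge0.
have pB t : 0 < t <= 1 -> p.[t] <= B.
  move=> /andP[t_gt0 t_le1]; rewrite horner_coef ler_sum // => i _.
  rewrite (le_trans (ler_norm _)) // normrM ler_piMr // normrX gtr0_norm //.
  by rewrite exprn_ile1 // ltW.
have den_gt0 : 0 < B - c + 1 by lra.
(* For this [t], the bound [t * B + c] on the value equals [- t * (1 - c)], which is negative. *)
have [t [t_gt0 t_le1 tE]] : exists t, [/\ 0 < t, t <= 1 & t * (B - c + 1) = - c].
  exists (- c / (B - c + 1)); split; last by rewrite divfK // gt_eqF.
    by rewrite divr_gt0 ?oppr_gt0.
  by rewrite ler_pdivrMr //; lra.
exists t; first by rewrite t_gt0.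
have := pB t; rewrite t_gt0 t_le1 => /(_ isT) pt; rewrite !hornerE.
have : 0 <= t * (B - p.[t]) by rewrite mulr_ge0 ?subr_ge0 // ltW.
have : 0 < t * (1 - c) by rewrite mulr_gt0 //; lra.
lra.
Qed.

(** Diagonal dominance after rescaling: with [m a = K a a * q a ^ 2], each entry is at most
    [h a b * (m a + m b) / 2] in absolute value. As [h a a = 1], the off-diagonal row sums of [h]
    are at most 1. *)
Lemma quadratic_form_ge0 (F : realFieldType) (I : finType)
    (K h : I -> I -> F) (q : I -> F) :
  (forall a, 0 <= K a a) -> (forall a b, 0 <= h a b) ->
  (forall a b, h a b = h b a) -> (forall a, h a a = 1) ->
  (forall a b, K a b ^+ 2 <= h a b ^+ 2 * (K a a * K b b)) ->
  (forall a, \sum_b h a b <= 2) ->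
  0 <= \sum_a \sum_b K a b * (q a * q b).
Proof.
move=> K0 h0 hC h1 Kh hsum.
pose m a := K a a * q a ^+ 2.
have m0 a : 0 <= m a by rewrite mulr_ge0 ?sqr_ge0.
have entry a b : (if b == a then 2 * m a else 0) - h a b * m a / 2 - h a b * m b / 2
    <= K a b * (q a * q b).
  case: eqVneq => [->|_]; first by rewrite h1 /m; lra.
  suff : `|K a b * (q a * q b)| <= h a b * (m a + m b) / 2.
    by rewrite ler_norml => /andP[]; lra.
  have rhs0 : 0 <= h a b * (m a + m b) / 2.
    by rewrite divr_ge0 // mulr_ge0 ?addr_ge0.
  rewrite -(@ler_pXn2r _ 2) ?nnegrE // -normrX ger0_norm ?sqr_ge0 //.
  have le1 : (K a b * (q a * q b)) ^+ 2 <= h a b ^+ 2 * (m a * m b).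
    have -> : h a b ^+ 2 * (m a * m b) = h a b ^+ 2 * (K a a * K b b) * (q a * q b) ^+ 2.
      by rewrite /m; ring.
    by rewrite exprMn ler_wpM2r ?sqr_ge0.
  apply: le_trans le1 _.
  have -> : (h a b * (m a + m b) / 2) ^+ 2 =
     h a b ^+ 2 * (m a * m b) + h a b ^+ 2 * ((m a - m b) / 2) ^+ 2 by field.
  by rewrite lerDl mulr_ge0 ?sqr_ge0.
suff le_entries : 0 <= \sum_a \sum_b ((if b == a then 2 * m a else 0) - h a b * m a / 2
     - h a b * m b / 2).
  apply: le_trans le_entries _; apply: ler_sum => a _; exact: ler_sum.
have -> : \sum_a \sum_b ((if b == a then 2 * m a else 0) - h a b * m a / 2
     - h a b * m b / 2) = \sum_a (2 - \sum_b h a b) * m a.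
  under eq_bigr => a _.
    rewrite !big_split /= -big_mkcond big_pred1_eq sumrN.
    rewrite (eq_bigr (fun b => h a b * (m a / 2))); last by move=> b _; rewrite mulrA.
    rewrite -mulr_suml sumrN; over.
  rewrite !big_split /= [X in _ + X]sumrN exchange_big /=.
  under [X in _ - X]eq_bigr => b _.
    rewrite (eq_bigr (fun a => h b a * (m b / 2))); last by move=> a _; rewrite hC mulrA.
    rewrite -mulr_suml; over.
  rewrite -sumrN -!big_split /=; apply: eq_bigr => a _; by field.
apply: sumr_ge0 => a _; by rewrite mulr_ge0 ?m0 // subr_ge0 hsum.
Qed.

(** The two-sided geometric series of ratio [1 / 6] sums to [1 + 2 / 5]. The base 6 is chosen so
    that the square [49 / 25] of this bound stays below 2, as [quadratic_form_ge0] demands in two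
    dimensions. *)
Lemma geometric_sum_le (F : realFieldType) (i n : nat) :
  \sum_(j < n) (6%:R^-1 : F) ^+ `|i - j|%N <= 7 / 5.
Proof.
set s : F := 6%:R^-1.
have s0 : 0 < s by rewrite invr_gt0.
have sE : 6 * s = 1 by rewrite mulfV ?pnatr_eq0.
have low k : (k <= i)%N -> \sum_(j < k) s ^+ `|i - j|%N <= s ^+ (i - k) / 5.
  elim: k => [|k IH] ki; first by rewrite big_ord0 divr_ge0 // exprn_ge0 // ltW.
  rewrite big_ord_recr /= distnEl ?(ltnW ki) //.
  have -> : (i - k = (i - k.+1).+1)%N by lia.
  have := IH (ltnW ki); have -> : (i - k = (i - k.+1).+1)%N by lia.
  rewrite exprS; have := exprn_gt0 (i - k.+1) s0.
  move: (s ^+ _) (\sum_(_ < _) _) => x y; nra.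
have high k : \sum_(j < i.+1 + k) s ^+ `|i - j|%N <= 7 / 5 - s ^+ k / 5.
  elim: k => [|k IH].
    rewrite addn0 big_ord_recr /= distnn expr0; have := low i (leqnn i).
    by rewrite subnn expr0; lra.
  rewrite addnS big_ord_recr /= distnEr; last by lia.
  have -> : (i.+1 + k - i = k.+1)%N by lia.
  rewrite !exprS; have := exprn_gt0 k s0; move: IH.
  move: (s ^+ _) (\sum_(_ < _) _) => x y; nra.
have [ni|ni] := leqP n i.
  apply: le_trans (low n ni) _.
  have : s ^+ (i - n) <= 1 by rewrite exprn_ile1 ?ltW //; lra.
  lra.
rewrite -(subnKC ni); apply: le_trans (high _) _.
have : 0 < s ^+ (n - i.+1) by rewrite exprn_gt0.
lra.
Qed.

(* The quadratic term gives strict midpoint convexity. The truncated differences form a convex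
   function vanishing exactly on the triangle [(0,0)], [(2,1)], [(1,2)], which leaves room to
   raise the value at its centroid [(1,1)] to the maximum over the vertices: this makes the
   functional negative on the Motzkin polynomial. *)
Definition wexp (a b : nat) : nat :=
  2 * (a ^ 2 + b ^ 2) + 12 * ((a - 2 * b) + (b - 2 * a) + (a + b - 3))
  + 6 * ((a == 1) && (b == 1)).

(** The two sides of the parallelogram identity differ by [(a - b) ^ 2]. Since [a - b] is even, say
    [2 * d] up to sign, this is [4 * d ^ 2 >= 4 * d]. *)
Lemma sqr_midpoint (a b c : nat) : (a + b = c.*2 ->
  4 * c ^ 2 + 2 * `|a - b| <= 2 * (a ^ 2 + b ^ 2))%N.
Proof.
move=> abc; have [d [[-> ->]|[-> ->]]] : exists d : nat,
    ((a = b + d.*2 /\ c = b + d) \/ (b = a + d.*2 /\ c = a + d))%N.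
  by have [ab|ba] := leqP a b; [exists (c - a)%N | exists (c - b)%N]; lia.
  have -> : `|b + d.*2 - b|%N = d.*2 by lia.
  have dd : (d <= d * d)%N by case: d => // d; rewrite leq_pmulr.
  by rewrite -!mulnn; nia.
have -> : `|a - (a + d.*2)|%N = d.*2 by lia.
have dd : (d <= d * d)%N by case: d => // d; rewrite leq_pmulr.
by rewrite -!mulnn; nia.
Qed.

Lemma wexp_midpoint a1 a2 b1 b2 c1 c2 :
  (a1 + b1 = c1.*2 -> a2 + b2 = c2.*2 ->
  2 * wexp c1 c2 + 2 * (`|a1 - b1| + `|a2 - b2|) <= wexp a1 a2 + wexp b1 b2)%N.
Proof.
move=> e1 e2; case: (boolP ((c1 == 1) && (c2 == 1))) => [/andP[/eqP c1E /eqP c2E] | cN1].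
  subst c1 c2.
  (* Only at the midpoint [(1, 1)] does the extra 6 work against the inequality; nine pairs have
     this midpoint. *)
  have : (a1, b1) \in [:: (0, 2); (1, 1); (2, 0)]%N by rewrite !inE !xpair_eqE; lia.
  have : (a2, b2) \in [:: (0, 2); (1, 1); (2, 0)]%N by rewrite !inE !xpair_eqE; lia.
  by rewrite !inE => /or3P[] /eqP[-> ->] /or3P[] /eqP[-> ->].
have edge1 : (2 * (c1 - 2 * c2) <= (a1 - 2 * a2) + (b1 - 2 * b2))%N by lia.
have edge2 : (2 * (c2 - 2 * c1) <= (a2 - 2 * a1) + (b2 - 2 * b1))%N by lia.
have edge3 : (2 * (c1 + c2 - 3) <= (a1 + a2 - 3) + (b1 + b2 - 3))%N by lia.
move: edge1 edge2 edge3 (sqr_midpoint e1) (sqr_midpoint e2).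
(* The extra terms at the endpoints only increase the larger side, so they may be arbitrary
   naturals. *)
rewrite /wexp (negbTE cN1); move: (_ && _ : nat) (_ && _ : nat) => da db.
move: (c1 - _)%N (c2 - _)%N (c1 + _ - _)%N (a1 - 2 * _)%N (a2 - _)%N (a1 + _ - _)%N.
move: (b1 - 2 * _)%N (b2 - _)%N (b1 + _ - _)%N (c1 ^ 2)%N (c2 ^ 2)%N.
move: (a1 ^ 2)%N (a2 ^ 2)%N (b1 ^ 2)%N (b2 ^ 2)%N `|a1 - b1|%N `|a2 - b2|%N => {e1 e2 cN1} *.
lia.
Qed.

(** * The functional and its positivity on squares *)

Section Functional.
Variable F : realFieldType.
Implicit Types (p q : {poly {poly F}}).

Definition coef_sum (V : nmodType) (R : nzSemiRingType) (g : nat -> R -> V) (p : {poly R}) : V :=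
  \sum_(i < size p) g i p`_i.

Definition weight (i j : nat) : F :=
  if odd i || odd j then 0 else 6%:R ^+ wexp i./2 j./2.

(** This is the functional [L]. The outer indeterminate is [y] and the inner one [x], matching the
    evaluation [p.[y%:P].[x]]. *)
Definition wsum (p : {poly {poly F}}) : F :=
  coef_sum (fun j => coef_sum (fun i c => c * weight i j)) p.

Lemma coef_sumE (V : nmodType) (R : nzSemiRingType) (g : nat -> R -> V) (p : {poly R}) n :
  (forall i, g i 0 = 0) -> (size p <= n)%N -> coef_sum g p = \sum_(i < n) g i p`_i.
Proof.
move=> g0 pn; rewrite /coef_sum (big_ord_widen _ (fun i => g i p`_i) pn).
rewrite big_mkcond; apply: eq_bigr => i _; case: ltnP => // le_pi.
by rewrite nth_default ?g0.
Qed.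

Lemma coef_sumD (V : nmodType) (R : nzSemiRingType) (g : nat -> R -> V) :
  (forall i, g i 0 = 0) -> (forall i, {morph g i : x y / x + y}) ->
  {morph coef_sum g : p q / p + q}.
Proof.
move=> g0 gD p q; set n := maxn (size p) (size q).
rewrite !(@coef_sumE _ _ g _ n) ?leq_maxl ?leq_maxr ?size_polyD //.
by rewrite -big_split /=; apply: eq_bigr => i _; rewrite coefD gD.
Qed.

Lemma coef_sum0 (V : nmodType) (R : nzSemiRingType) (g : nat -> R -> V) : coef_sum g 0 = 0.
Proof. by rewrite /coef_sum size_poly0 big_ord0. Qed.

Lemma wsumD : {morph wsum : p q / p + q}.
Proof.
apply: coef_sumD => [i|i p q]; first exact: coef_sum0.
by apply: coef_sumD => [k|k x y]; rewrite ?mul0r ?mulrDl.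
Qed.

Lemma wsum_sum (I : Type) (s : seq I) (P : pred I) (f : I -> {poly {poly F}}) :
  wsum (\sum_(i <- s | P i) f i) = \sum_(i <- s | P i) wsum (f i).
Proof. exact: (big_morph _ wsumD (coef_sum0 _)). Qed.

Lemma wsumZ (c : F) p : wsum (c%:P%:P * p) = c * wsum p.
Proof.
have size_le (R : comNzRingType) (b : R) (g : {poly R}) : (size (b%:P * g)%R <= size g)%N.
  by rewrite mul_polyC size_scale_leq.
rewrite /wsum (coef_sumE (fun=> coef_sum0 _) (size_le _ _ _)).
rewrite {2}/coef_sum mulr_sumr; apply: eq_bigr => j _; rewrite coefCM.
rewrite (coef_sumE _ (size_le _ _ _)) => [|i]; last by rewrite mul0r.
by rewrite /coef_sum mulr_sumr; apply: eq_bigr => i _; rewrite coefCM mulrA.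
Qed.

Definition bimonom (i j : nat) : {poly {poly F}} := ('X^i)%:P * 'X^j.

Lemma bimonomM i j k l : bimonom i j * bimonom k l = bimonom (i + k) (j + l).
Proof. by rewrite /bimonom mulrACA -polyCM -!exprD. Qed.

Lemma coef_sumXn (V : nmodType) (R : nzSemiRingType) (g : nat -> R -> V) (c : R) n :
  (forall i, g i 0 = 0) -> coef_sum g (c%:P * 'X^n) = g n c.
Proof.
move=> g0; rewrite (@coef_sumE _ _ _ _ n.+1) //; last first.
  by rewrite mul_polyC (leq_trans (size_scale_leq _ _)) ?size_polyXn.
rewrite (bigD1 ord_max) //= coefCM coefXn eqxx mulr1 big1 ?addr0 // => i.
by rewrite -val_eqE /= => /negbTE iN; rewrite coefCM coefXn iN mulr0 g0.
Qed.

Lemma wsum_bimonom i j : wsum (bimonom i j) = weight i j.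
Proof.
rewrite /wsum /bimonom coef_sumXn => [|k]; last exact: coef_sum0.
by rewrite -['X^i]mul1r coef_sumXn ?mul1r // => k; rewrite mul0r.
Qed.

Lemma poly_expand (R : nzSemiRingType) (p : {poly R}) n : (size p <= n)%N ->
  p = \sum_(i < n) (p`_i)%:P * 'X^i.
Proof.
move=> pn; rewrite -{1}[p]coefK poly_def (big_ord_widen _ (fun i => p`_i *: 'X^i) pn).
rewrite big_mkcond; apply: eq_bigr => i _; rewrite mul_polyC; case: ltnP => // le_pi.
by rewrite nth_default ?scale0r.
Qed.

Lemma bipoly_expand q : exists n,
  q = \sum_(a : 'I_n * 'I_n) (q`_a.2`_a.1)%:P%:P * bimonom a.1 a.2.
Proof.
pose n := maxn (size q) (\max_(j < size q) size (q`_j)%R); exists n.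
rewrite -(pair_bigA _ (fun i j : 'I_n => (q`_j`_i)%:P%:P * bimonom i j)) exchange_big /=.
rewrite {1}(@poly_expand _ q n) ?leq_maxl //; apply: eq_bigr => j _.
rewrite {1}(@poly_expand _ q`_j n).
  rewrite rmorph_sum mulr_suml; apply: eq_bigr => i _.
  by rewrite /bimonom /= polyCM mulrA.
have [jq|qj] := ltnP j (size q); last by rewrite nth_default ?size_poly0.
by rewrite leq_max (leq_bigmax (Ordinal jq)) orbT.
Qed.

(** Expanding [q] in monomials gives the quadratic form of the moment matrix [K]. Midpoint convexity
    of [wexp] makes [K a b] decay, relative to the diagonal, like [6 ^ - d] with [d] the l1 distance
    of the exponents. *)
Lemma wsum_square_ge0 q : 0 <= wsum (q * q).
Proof.
have [n qE] := bipoly_expand q.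
pose c (a : 'I_n * 'I_n) := q`_a.2`_a.1.
pose K (a b : 'I_n * 'I_n) := weight (a.1 + b.1) (a.2 + b.2).
pose s : F := 6%:R^-1.
pose h (a b : 'I_n * 'I_n) := s ^+ `|a.1 - b.1|%N * s ^+ `|a.2 - b.2|%N.
have s0 : 0 <= s by rewrite invr_ge0.
have -> : wsum (q * q) = \sum_a \sum_b K a b * (c a * c b).
  rewrite {1 2}qE mulr_suml wsum_sum; apply: eq_bigr => a _.
  rewrite mulr_sumr wsum_sum; apply: eq_bigr => b _.
  by rewrite mulrACA bimonomM -!polyCM wsumZ wsum_bimonom mulrC.
have KaaE a : K a a = 6%:R ^+ wexp a.1 a.2.
  by rewrite /K /weight !addnn !odd_double !doubleK.
apply: (@quadratic_form_ge0 _ _ K h).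
- by move=> a; rewrite KaaE exprn_ge0.
- by move=> a b; rewrite mulr_ge0 ?exprn_ge0.
- by move=> a b; rewrite /h distnC [X in _ * _ ^+ X]distnC.
- by move=> a; rewrite /h !distnn mulr1.
- move=> a b; rewrite !KaaE {1}/K /weight; case: ifPn => [_|].
    by rewrite expr0n /= mulr_ge0 ?sqr_ge0 // mulr_ge0 ?exprn_ge0.
  rewrite negb_or => /andP[even1 even2].
  have := wexp_midpoint (esym (even_halfK even1)) (esym (even_halfK even2)).
  set d := (`|a.1 - b.1| + `|a.2 - b.2|)%N => mid.
  have hE : h a b * 6%:R ^+ d = 1.
    by rewrite /h -exprD -exprMn mulVf ?pnatr_eq0 // expr1n.
  rewrite -exprM -exprD.
  (* Inserting [(h a b * 6 ^ d) ^ 2 = 1] makes the exponent exactly the one bounded by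
     [wexp_midpoint]. *)
  have -> : 6%:R ^+ (wexp (a.1 + b.1)./2 (a.2 + b.2)./2 * 2) =
     h a b ^+ 2 * 6%:R ^+ (2 * wexp (a.1 + b.1)./2 (a.2 + b.2)./2 + 2 * d).
    by rewrite exprD [(2 * d)%N]mulnC (exprM _ d) mulrCA -exprMn hE expr1n mulr1 mulnC.
  by rewrite ler_wpM2l ?sqr_ge0 // ler_weXn2l // ler1n.
move=> a; rewrite -(pair_bigA _ (fun i j : 'I_n => s ^+ `|a.1 - i|%N * s ^+ `|a.2 - j|%N)) /=.
under eq_bigr => i _ do rewrite -mulr_sumr.
rewrite -mulr_suml.
have := geometric_sum_le F a.1 n; have := geometric_sum_le F a.2 n.
rewrite -/s; set x := \sum_(_ < _) _; set y := \sum_(_ < _) _ => y1 x1.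
have x0 : 0 <= x by apply: sumr_ge0 => i _; rewrite exprn_ge0.
have y0 : 0 <= y by apply: sumr_ge0 => i _; rewrite exprn_ge0.
nra.
Qed.

End Functional.

(** The outermost indeterminate is [t]. By linearity, the value of the functional at [t] is itself a
    polynomial in [t], so negativity persists near 0. *)
Lemma perturbed_wsum_lt0 (F : realFieldType) (W : {poly {poly {poly F}}}) :
  wsum W.[0] < 0 -> exists2 t : F, 0 < t <= 1 & wsum W.[t%:P%:P] < 0.
Proof.
pose phi := \poly_(k < size W) wsum W`_k.
have phiE t : phi.[t] = wsum W.[t%:P%:P].
  rewrite horner_poly horner_coef wsum_sum; apply: eq_bigr => k _.
  by rewrite -!rmorphXn [in RHS]mulrC wsumZ mulrC.
have := phiE 0; rewrite !polyC0 => <- /poly_neg_near0[t t01]; rewrite phiE.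
by exists t.
Qed.

Lemma perturbed_motzkin_not_sos (F : realFieldType) (r : nat) :
  exists2 t : F, 0 < t <= 1 & forall qs : seq {poly {poly F}},
    ~ (forall x y : F,
      (x ^+ 4 * y ^+ 2 + x ^+ 2 * y ^+ 4 + 1 - 3 * x ^+ 2 * y ^+ 2
       + t * (1 + t ^+ 2 * (x ^+ 2 + y ^+ 2) + t ^+ 6 * (x ^+ 6 + y ^+ 6)))
      * (1 + t ^+ 2 * (x ^+ 2 + y ^+ 2)) ^+ r = \sum_(q <- qs) q.[y%:P].[x] ^+ 2).
Proof.
pose X := bimonom F 1 0; pose Y := bimonom F 0 1.
pose M := X ^+ 4 * Y ^+ 2 + X ^+ 2 * Y ^+ 4 + 1 - 3 * X ^+ 2 * Y ^+ 2.
pose W : {poly {poly {poly F}}} :=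
  (M%:P + 'X * (1 + 'X ^+ 2 * (X ^+ 2 + Y ^+ 2)%:P + 'X ^+ 6 * (X ^+ 6 + Y ^+ 6)%:P))
  * (1 + 'X ^+ 2 * (X ^+ 2 + Y ^+ 2)%:P) ^+ r.
have powM i j k : bimonom F i j ^+ k = bimonom F (k * i) (k * j).
  elim: k => [|k IH]; first by rewrite /bimonom !expr0 mulr1.
  by rewrite exprS IH bimonomM !mulSn.
have W0 : wsum W.[0] < 0.
  have -> : W.[0] = M.
    rewrite /W; move: (M) (X ^+ 2 + _) (X ^+ 6 + _) => m a b.
    by rewrite !hornerE /= !expr0n /= !mul0r !addr0 expr1n mulr1.
  have -> : M = bimonom F 4 2 + bimonom F 2 4 + bimonom F 0 0 + (-3)%:P%:P * bimonom F 2 2.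
    have -> : bimonom F 0 0 = 1 by rewrite /bimonom mulr1.
    by rewrite /M -mulrA !powM !bimonomM !polyCN !polyC_natr mulNr.
  rewrite !wsumD !wsum_bimonom wsumZ wsum_bimonom.
  (* The Motzkin polynomial is sent to [6 ^ 10 + 6 ^ 10 + 1 - 3 * 6 ^ 10 = 1 - 6 ^ 10]. *)
  rewrite -[weight F 4 2]/(6%:R ^+ 10) -[weight F 2 4]/(6%:R ^+ 10) -[weight F 0 0]/1.
  rewrite -[weight F 2 2]/(6%:R ^+ 10).
  have : 2 <= 6%:R ^+ 10 :> F by rewrite -natrX ler_nat.
  lra.
have [t t01 Wt] := perturbed_wsum_lt0 W0; exists t => // qs sos.
have WtE : W.[t%:P%:P] = \sum_(q <- qs) q * q.
  apply/eqP; rewrite -subr_eq0; apply/eqP/bipoly_fun_eq0 => x y.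
  rewrite !hornerD !hornerN; apply/eqP; rewrite subr_eq0; apply/eqP.
  rewrite !horner_sum (eq_bigr (fun q => q.[y%:P].[x] ^+ 2)) => [|q _]; last first.
    by rewrite !hornerM.
  have eX : X.[y%:P].[x] = x by rewrite !hornerE.
  have eY : Y.[y%:P].[x] = y by rewrite !hornerE.
  rewrite -sos /W /M; move: (X) (Y) eX eY => X' Y' eX eY.
  rewrite !(hornerM, horner_exp, hornerD, hornerN, hornerC, hornerX).
  by rewrite eX eY.
move: Wt; rewrite WtE wsum_sum; apply/negP; rewrite -leNgt.
by apply: sumr_ge0 => q _; apply: wsum_square_ge0.
Qed.

(** * Conclusion *)

Local Open Scope R_scope.

(** A bridge between the two encodings of polynomials: values of an [mpoly] on the slice are matched
    semantically, with no syntactic translation. *)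
Definition bipoly_fun (g : R -> R -> R) : Prop :=
  exists Q : {poly {poly R}}, forall x y : R, (Q.[y%:P].[x])%R = g x y.

Lemma bipoly_fun_cst c : bipoly_fun (fun _ _ => c).
Proof. by exists (c%:P%:P)%R => x y; rewrite !hornerC. Qed.

Lemma bipoly_fun_fst : bipoly_fun (fun x _ => x).
Proof. by exists ('X%:P)%R => x y; rewrite hornerC hornerX. Qed.

Lemma bipoly_fun_snd : bipoly_fun (fun _ y => y).
Proof. by exists 'X%R => x y; rewrite hornerX hornerC. Qed.

Lemma bipoly_funD f g : bipoly_fun f -> bipoly_fun g ->
  bipoly_fun (fun x y => f x y + g x y).
Proof. by move=> [P Pf] [Q Qg]; exists (P + Q)%R => x y; rewrite !hornerD Pf Qg. Qed.

Lemma bipoly_funM f g : bipoly_fun f -> bipoly_fun g ->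
  bipoly_fun (fun x y => f x y * g x y).
Proof. by move=> [P Pf] [Q Qg]; exists (P * Q)%R => x y; rewrite !hornerM Pf Qg. Qed.

Lemma bipoly_funX f n : bipoly_fun f -> bipoly_fun (fun x y => f x y ^ n).
Proof.
move=> bf; elim: n => [|n IH]; first exact: bipoly_fun_cst.
exact: bipoly_funM.
Qed.

Lemma bipoly_fun_peval n (z : R -> R -> nat -> R) (q : mpoly) :
  (forall i, bipoly_fun (fun x y => z x y i)) -> bipoly_fun (fun x y => peval n q (z x y)).
Proof.
move=> bz; elim: q => [|[c e] q IH]; first exact: bipoly_fun_cst.
apply: bipoly_funD => //; apply: bipoly_funM; first exact: bipoly_fun_cst.
rewrite /eval_mon /=; elim: n {IH} => [|n IHn]; first exact: bipoly_fun_cst.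
by apply: bipoly_funM => //; apply: bipoly_funX.
Qed.

Theorem theorem6 : forall r : nat, exists f : mpoly,
  is_form 3 8 f /\ hessian_pd_away_from_0 3 f /\ ~ r_sos_convex 3 r f.
Proof.
move=> r; have [t /andP[/RltP t_gt0 /RleP t_le1] not_sos] := perturbed_motzkin_not_sos R r.
(* [t] is fixed by [r] alone; [K] may then depend on [t], since it is invisible on the slice. *)
have [K Kpd] := hessian_octic_pd t (conj t_gt0 t_le1).
exists (octic t K); split; first exact: octic_is_form.
split => // -[qs sos].
have slice_fun k : bipoly_fun (fun x y => slice_point t x y k).
  case: k => [|[|[|[|k]]]]; do ?exact: bipoly_fun_cst.
    by apply: bipoly_funM; [exact: bipoly_fun_cst | exact: bipoly_fun_fst].
  by apply: bipoly_funM; [exact: bipoly_fun_cst | exact: bipoly_fun_snd].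
have [Qs QsE] : exists Qs : seq {poly {poly R}}, forall x y : R,
    (\sum_(Q <- Qs) Q.[y%:P].[x] ^+ 2)%R =
    fold_right (fun q acc => (peval 6 q (slice_point t x y) * / t ^ 3) ^ 2 + acc) 0 qs.
  elim: qs {sos} => [|q qs [Qs QsE]]; first by exists [::] => x y; rewrite big_nil.
  have [Q QE] : bipoly_fun (fun x y => peval 6 q (slice_point t x y) * / t ^ 3).
    by apply: bipoly_funM; [exact: bipoly_fun_peval | exact: bipoly_fun_cst].
  by exists (Q :: Qs) => x y; rewrite big_cons QsE QE -RpowE.
apply: (not_sos Qs) => x y; rewrite QsE -!RpowE.
exact: scaled_slice_sos (Rgt_not_eq _ _ t_gt0) sos x y.
Qed.
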